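(* Let $X$ be a real Banach space with norm $\|\cdot\|$, let $C^0([0,1];X)$ be the space of continuous mappings from $[0,1]$ to $X$, and let $\Phi:X\to\mathbb{R}$ be a locally Lipschitz functional. For $z_0,z_1\in X$ define $$\Gamma:=\{c\in C^0([0,1];X): c(0)=z_0,\ c(1)=z_1\},\qquad \gamma:=\inf_{c\in\Gamma}\max_{0\le t\le 1}\Phi(c(t)),$$ and set $\Phi_\gamma:=\{x\in X:\Phi(x)\ge\gamma\}$. Let $F\subset X$ be a closed subset such that $F\cap\Phi_\gamma$ separates $z_0$ and $z_1$. If $\Phi$ satisfies the $(CPS)_{F,\gamma;\delta}$ condition, then $\gamma$ is a critical value of $\Phi$: there exists $\bar x\in X$ with $\Phi(\bar x)=\gamma$ and $0\in\partial\Phi(\bar x)$.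
   Context: For a locally Lipschitz $\Phi:X\to\mathbb{R}$, the generalized directional derivative at $x$ along $v$ is $\Phi^0(x,v):=\limsup_{w\to x,\ t\downarrow 0}\frac{\Phi(w+tv)-\Phi(w)}{t}$, and the Clarke generalized gradient is $\partial\Phi(x):=\{x^*\in X^*:\langle x^*,v\rangle\le\Phi^0(x,v)\ \forall v\in X\}$; $\|y^*\|$ for $y^*\in X^*$ is the dual norm. The $\delta$-distance on $X$ is $\delta(x_1,x_2):=\inf\{l(c): c\in C^1([0,1],X),\ c(0)=x_1,\ c(1)=x_2\}$ with $l(c):=\int_0^1\frac{\|\dot c(t)\|}{1+\|c(t)\|}\,dt$, and $\mathrm{dist}_\delta(x,F):=\inf\{\delta(x,y):y\in F\}$. $\Phi$ satisfies the $(CPS)_{F,c;\delta}$ condition if every sequence $\{x_n\}\subset X$ with $\mathrm{dist}_\delta(x_n,F)\to 0$, $\Phi(x_n)\to c$ and $(1+\|x_n\|)\min_{y^*\in\partial\Phi(x_n)}\|y^*\|\to 0$ has a (norm-)convergent subsequence. A closed set $H\subset X$ separates $z_0$ and $z_1$ if $z_0,z_1\in X\setminus H$ lie in different connected components of $X\setminus H$ (equivalently, $X\setminus H=\Omega_0\cup\Omega_1$ with $\Omega_0,\Omega_1$ disjoint open sets, $z_0\in\Omega_0$, $z_1\in\Omega_1$). *)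

(* Defs.v *)
From HB Require Import structures.
From mathcomp Require Import all_boot all_order all_algebra.
From mathcomp Require Import all_classical all_reals all_analysis.

Set Implicit Arguments.
Unset Strict Implicit.
Unset Printing Implicit Defensive.

Import Order.TTheory GRing.Theory Num.Theory.
Import numFieldNormedType.Exports.

Local Open Scope classical_set_scope.
Local Open Scope ring_scope.

Section clarke.
Context {R : realType} {X : normedModType R}.
Implicit Types (Phi : X -> R) (x v : X).

Definition locally_lipschitz Phi :=
  forall x, exists2 U : set X, nbhs x U & [lipschitz Phi y | y in U].

(* The limsup is taken along the product of the filters w --> x and t --> 0^+. *)
Definition gen_dir_deriv Phi x v : \bar R :=
  limf_esup (fun p : X * R => ((Phi (p.1 + p.2 *: v) - Phi p.1) / p.2)%:E)
            (filter_prod (nbhs x) 0^'+).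

(* The topological dual is the set of continuous elements of
   {linear X -> R^o}. *)
Definition clarke_gradient Phi x : set {linear X -> R^o} :=
  [set f : {linear X -> R^o} |
    continuous f /\ forall v, ((f v : R)%:E <= gen_dir_deriv Phi x v)%E].

Definition dual_norm (f : {linear X -> R^o}) : R :=
  sup [set `|f x| | x in [set x : X | `|x| <= 1]].

(* For Phi locally Lipschitz, the Clarke gradient is nonempty and weak-star
   compact and the dual norm is weak-star lower semicontinuous, so that this
   infimum is a minimum. *)
Definition min_gradient_norm Phi x : R :=
  inf [set dual_norm f | f in clarke_gradient Phi x].

Definition critical_value Phi (c : R) :=
  exists x, Phi x = c /\ clarke_gradient Phi x \0.

End clarke.

Section delta_distance.
Context {R : realType} {X : normedModType R}.
Implicit Types (c : R -> X) (x y : X) (F : set X).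

(* Paths on [0, 1] are functions on R of which only the values on `[0, 1] are
   used: all limits are taken within `[0, 1], hence are one-sided at 0 and 1. *)
Definition diff_quotient01 c (t : R) : set_system X :=
  (s - t)^-1 *: (c s - c t) @[s --> within `[0, 1] t^'].

Definition deriv01 c (t : R) : X := lim (diff_quotient01 c t).

Definition C1_path c :=
  (forall t, `[0, 1]%classic t -> cvg (diff_quotient01 c t)) /\
  {within `[0, 1], continuous (deriv01 c)}.

Definition delta_length c : R :=
  \int[lebesgue_measure]_(t in `[0, 1]) (`|deriv01 c t| / (1 + `|c t|)).

Definition delta_dist x y : R :=
  inf [set delta_length c | c in [set c | [/\ C1_path c, c 0 = x & c 1 = y]]].

(* Extended-real valued, so that the distance to the empty set is +oo. *)
Definition dist_delta x F : \bar R :=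
  ereal_inf [set (delta_dist x y)%:E | y in F].

End delta_distance.

Definition CPS {R : realType} {X : normedModType R}
    (Phi : X -> R) (F : set X) (c : R) :=
  forall x : nat -> X,
    dist_delta (x n) F @[n --> \oo] --> 0%E ->
    Phi (x n) @[n --> \oo] --> c ->
    (1 + `|x n|) * min_gradient_norm Phi (x n) @[n --> \oo] --> (0 : R) ->
    exists2 k : nat -> nat, increasing_seq k & cvgn (x \o k).

Definition separates {T : topologicalType} (H : set T) (z0 z1 : T) :=
  [/\ closed H, (~` H) z0, (~` H) z1 &
      connected_component (~` H) z0 <> connected_component (~` H) z1].

Section minimax.
Context {R : realType} {X : normedModType R}.

Definition C0_paths (z0 z1 : X) : set (R -> X) :=
  [set c : R -> X | [/\ {within `[0, 1], continuous c}, c 0 = z0 & c 1 = z1]].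

(* For Phi and c continuous, the supremum over t is a maximum. *)
Definition minimax_value (Phi : X -> R) (z0 z1 : X) : R :=
  inf [set sup [set Phi (c t) | t in `[0, 1]] | c in C0_paths z0 z1].

End minimax.

(* Main.v *)
From HB Require Import structures.
Require Import Defs.
From mathcomp Require Import all_boot all_order all_algebra.
From mathcomp Require Import all_classical all_reals all_analysis.
From mathcomp Require finmap.
From mathcomp Require Import ring lra.
Import Order.TTheory GRing.Theory Num.Theory.
Import numFieldNormedType.Exports.
Local Open Scope classical_set_scope.
Local Open Scope ring_scope.

(* On paths from [z0] to [z1], minimize the maximum of [Phi] minus [e] times a
   distance to [F], freezing the path where it starts far from [F].  As every
   path meets [F] above the level [gamma], this functional stays above [gamma],
   and the maximum of a minimal path is attained away from the endpoints, near
   [F] and at height near [gamma].  If [Phi] had a uniform descent direction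
   (relative to [1 + |x|]) at all maximum points, a pseudo-gradient vector field
   would push the path below its minimal height.  So some point has almost
   nonnegative directional derivatives; by the Hahn-Banach theorem it has a small
   Clarke subgradient, and the compactness condition gives a limit of such
   points, which is critical by upper semicontinuity of the directional
   derivative. *)

(** * The Hahn-Banach theorem *)

Lemma le_inf_add {R : realType} (A B : set R) (z : R) : A !=set0 -> B !=set0 ->
  (forall x y, A x -> B y -> z <= x + y) -> z <= inf A + inf B.
Proof.
move=> A0 B0 H; rewrite -lerBlDr; apply: lb_le_inf => // x Ax.
rewrite lerBlDr -lerBlDl; apply: lb_le_inf => // y By.
by rewrite lerBlDl H.
Qed.

Section HahnBanach.
Context {R : realType} {V : lmodType R}.
Implicit Types (p q : V -> R) (u v a : V).

(** Homogeneity is imposed only as an inequality for positive factors, the form that passes to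
    infima; applied to the inverse factor it gives equality. *)
Definition sublinear q :=
  (forall u v, q (u + v) <= q u + q v) /\
  (forall k v, 0 < k -> q (k *: v) <= k * q v).

Lemma sublinearZ {q k} v : sublinear q -> 0 <= k -> q (k *: v) = k * q v.
Proof.
move=> [_ qZ]; rewrite le_eqVlt => /predU1P[<-|k0].
  have h1 : q 0 <= 2^-1 * q 0 by have := qZ 2^-1 0; rewrite scaler0; apply; lra.
  have h2 : q 0 <= 2 * q 0 by have := qZ 2 0; rewrite scaler0; apply; lra.
  by rewrite scale0r; lra.
apply/eqP; rewrite eq_le qZ//=.
have := qZ k^-1 (k *: v); rewrite invr_gt0 scalerA mulVf ?gt_eqF// scale1r.
by move=> /(_ k0); rewrite mulrC ler_pdivlMr// mulrC.
Qed.

Lemma sublinear0 {q} : sublinear q -> q 0 = 0.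
Proof. by move=> sq; rewrite -(scale0r 0) sublinearZ// mul0r. Qed.

Lemma sublinear_geN {q} v : sublinear q -> - q (- v) <= q v.
Proof.
move=> sq; have := sq.1 v (- v); rewrite subrr sublinear0//; lra.
Qed.

(* [inf_(s >= 0) p (v + s a) - s p a] is sublinear and below [p]. *)
Lemma minimal_sublinear_additive {p} : sublinear p ->
  (forall q, sublinear q -> (forall v, q v <= p v) -> q = p) ->
  forall u v, p (u + v) = p u + p v.
Proof.
move=> sp pmin v a.
pose S u := [set p (u + s *: a) - s * p a | s in [set s | 0 <= s]].
have S0 u : S u !=set0 by exists (p (u + 0 *: a) - 0 * p a); exists 0 => /=.
have Slb u : has_lbound (S u).
  exists (- p (- u)) => _ [s /= s0 <-].
  have := sp.1 (u + s *: a) (- u); rewrite addrAC subrr add0r sublinearZ//; lra.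
pose q u := inf (S u).
have qle u s : 0 <= s -> q u <= p (u + s *: a) - s * p a.
  by move=> s0; apply: ge_inf => //; exists s.
have qp : q = p.
  apply: pmin => [|u]; last by have := qle u 0 (lexx _); rewrite scale0r addr0; lra.
  split=> [u w|k u k0].
    apply: le_inf_add => // _ _ [s /= s0 <-] [t /= t0 <-].
    apply: le_trans (qle _ (s + t) (addr_ge0 s0 t0)) _.
    have := sp.1 (u + s *: a) (w + t *: a).
    by rewrite addrACA -scalerDl; lra.
  rewrite -ler_pdivrMl//; apply: lb_le_inf => // _ [s /= s0 <-].
  rewrite ler_pdivrMl//; apply: le_trans (qle _ (k * s) _) _.
    by rewrite mulr_ge0// ltW.
  by rewrite -scalerA -scalerDr (sublinearZ _ sp (ltW k0)) mulrBr mulrA.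
have := qle v 1 ler01; rewrite qp scale1r mul1r => h.
apply/eqP; rewrite eq_le sp.1/=; lra.
Qed.

(** Zorn's lemma for the reversed pointwise order. A chain is bounded by its pointwise infimum,
    which is finite since every member is at least [- q (- v)] at [v], and subadditive since the
    smaller of two members serves both arguments. *)
Lemma exists_minimal_sublinear {q} : sublinear q ->
  exists2 p, sublinear p /\ (forall v, p v <= q v) &
    forall p', sublinear p' -> (forall v, p' v <= p v) -> p' = p.
Proof.
move=> sq; pose P p := sublinear p /\ forall v, p v <= q v.
pose T := {p : V -> R | P p}.
pose le_ (s t : T) := `[< forall v, sval t v <= sval s v >].
have [||||t tmax] := @Zorn T le_.
- by move=> t; apply/asboolP.
- move=> r s t /asboolP rs /asboolP st; apply/asboolP => v.
  exact: le_trans (st v) (rs v).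
- move=> [s Ps] [t Pt] /asboolP/= st /asboolP/= ts; apply: eq_exist.
  by apply/funext => v; apply/eqP; rewrite eq_le st ts.
- move=> A Atot; have [->|A0] := eqVneq A set0.
    by exists (exist P q (conj sq (fun=> lexx _))).
  have /set0P [t0 At0] := A0.
  pose S v := [set sval t v | t in A].
  have Snon v : S v !=set0 by exists (sval t0 v); exists t0.
  have Slb v : has_lbound (S v).
    exists (- q (- v)) => _ [[t [st tq]] At <-] /=.
    by apply: le_trans (sublinear_geN v st); rewrite lerN2.
  have ple t v : A t -> inf (S v) <= sval t v.
    by move=> At; apply: ge_inf => //; exists t.
  have sp : sublinear (fun v => inf (S v)).
    split=> [u w|k u k0].
      apply: le_inf_add => // _ _ [s As <-] [t At <-].
      have [/asboolP st|/asboolP ts] := Atot _ _ As At.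
        apply: le_trans (ple _ _ At) _.
        by apply: le_trans ((svalP t).1.1 _ _) _; rewrite lerD.
      apply: le_trans (ple _ _ As) _.
      by apply: le_trans ((svalP s).1.1 _ _) _; rewrite lerD.
    rewrite -ler_pdivrMl//; apply: lb_le_inf => // _ [s As <-].
    rewrite ler_pdivrMl//; apply: le_trans (ple _ _ As) _.
    exact: (svalP s).1.2.
  have pq v : inf (S v) <= q v.
    exact: le_trans (ple _ v At0) ((svalP t0).2 v).
  by exists (exist P _ (conj sp pq)) => s As; apply/asboolP => v /=; exact: ple.
exists (sval t); first exact: svalP t.
move=> p' sp' p't.
have p'q v : p' v <= q v by exact: le_trans (p't v) ((svalP t).2 v).
by rewrite -(tmax (exist P p' (conj sp' p'q)))//; apply/asboolP.
Qed.

(** A minimal sublinear function below [q] is additive, hence odd, so its positive homogeneity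
    extends to all scalars. *)
Lemma hahn_banach_sublinear {q} : sublinear q ->
  exists f : {linear V -> R^o}, forall v, f v <= q v.
Proof.
move=> /exists_minimal_sublinear[p [sp pq] pmin].
have pD := minimal_sublinear_additive sp pmin.
have pN v : p (- v) = - p v.
  by have := pD v (- v); rewrite subrr sublinear0//; lra.
have lp : linear (p : V -> R^o).
  move=> k u v; rewrite pD; congr (_ + _).
  have [k0|k0] := leP 0 k; first by rewrite sublinearZ.
  rewrite -[k]opprK scaleNr pN sublinearZ// ?oppr_ge0 ?ltW//.
  by rewrite scaleNr.
pose pL := GRing.isLinear.Build R V R^o *:%R p lp.
pose f : {linear V -> R^o} := HB.pack p pL.
by exists f.
Qed.

End HahnBanach.

(** * Clarke gradients *)

Section ClarkeGradient.
Context {R : realType} {X : normedModType R}.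
Implicit Types (Phi : X -> R) (x v : X) (m k : R).

(** A real-valued substitute for upper bounds on [gen_dir_deriv]: one radius controls base points
    and step sizes together, so that bounds can be added, rescaled and moved to nearby points
    without limsups. *)
Definition dir_le Phi x v m :=
  exists2 r, 0 < r & forall w s, `|x - w| < r -> 0 < s < r ->
    Phi (w + s *: v) - Phi w <= s * m.

Lemma gen_dir_deriv_lt {Phi x v m} :
  (gen_dir_deriv Phi x v < m%:E)%E -> exists2 m', m' < m & dir_le Phi x v m'.
Proof.
move=> /ereal_inf_lt[_ [A [[P Q] /= [/nbhs_ballP[r /= r0 rP] [e /= e0 eQ]] PQA]] <-].
move=> supm.
have [m' m'm supm'] : exists2 m', m' < m & (ereal_sup
    [set ((Phi (p.1 + p.2 *: v) - Phi p.1) / p.2)%:E | p in A] <= m'%:E)%E.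
  move: supm; case: ereal_sup => [a| |] //=; first by exists a.
  (* If the supremum is [-oo], any real number below [m] serves. *)
  by move=> _; exists (m - 1); rewrite ?leNye//; lra.
exists m' => //; exists (Num.min r e) => [|w s]; first by rewrite lt_min r0.
rewrite !lt_min => /andP[wr _] /andP[s0 /andP[_ se]].
have Aws : A (w, s).
  apply: PQA; split => /=; first by apply: rP; rewrite -ball_normE.
  by apply: eQ => //=; rewrite sub0r normrN gtr0_norm.
have : (((Phi (w + s *: v) - Phi w) / s)%:E <= m'%:E)%E.
  by apply: le_trans supm'; apply: ereal_sup_ubound; exists (w, s).
by rewrite lee_fin ler_pdivrMr// mulrC.
Qed.

Lemma dir_le0 Phi x : dir_le Phi x 0 0.
Proof. by exists 1 => // w s _ _; rewrite scaler0 addr0 subrr mulr0. Qed.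

Lemma dir_leZ {Phi x v m k} : 0 < k -> dir_le Phi x v m ->
  dir_le Phi x (k *: v) (k * m).
Proof.
move=> k0 [r r0 H]; exists (Num.min r (r / k)).
  by rewrite lt_min r0 divr_gt0.
move=> w s; rewrite !lt_min => /andP[wr _] /and3P[s0 sr srk].
rewrite scalerA mulrA; apply: H => //.
by rewrite mulr_gt0//= -ltr_pdivlMr.
Qed.

(** The increment along [v2] is taken from the displaced point [w + s *: v1], which the choice of
    radius keeps in the ball where the bound for [v2] holds. *)
Lemma dir_leD {Phi x v1 v2 m1 m2} : dir_le Phi x v1 m1 -> dir_le Phi x v2 m2 ->
  dir_le Phi x (v1 + v2) (m1 + m2).
Proof.
move=> [r1 r10 H1] [r2 r20 H2].
pose d := 1 + `|v1|.
have d0 : 0 < d by rewrite ltr_pwDl.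
exists (Num.min (r1 / 2) (Num.min (r2 / 2) (r2 / 2 / d))).
  by rewrite !lt_min !divr_gt0.
move=> w s; rewrite !lt_min => /and3P[w1 w2 _] /and4P[s0 s1 s2 s3].
have := H1 w s; have := H2 (w + s *: v1) s.
rewrite -addrA -scalerDr.
have -> : `|x - (w + s *: v1)| < r2.
  rewrite opprD addrA; apply: le_lt_trans (ler_normB _ _) _.
  rewrite normrZ gtr0_norm//.
  have : s * d < r2 / 2 by rewrite -ltr_pdivlMr.
  have : s * `|v1| <= s * d by rewrite ler_pM2l// lerDr.
  by move: (r2 / 2) (splitr r2) w2 => a ->; lra.
have -> : 0 < s < r2 by rewrite s0; lra.
have -> : 0 < s < r1 by rewrite s0; lra.
have -> : `|x - w| < r1 by lra.
by move=> /(_ isT isT) h2 /(_ isT isT) h1; lra.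
Qed.

(** Upper semicontinuity in the base point: the same slope survives on half the radius. *)
Lemma dir_le_near {Phi x v m} : dir_le Phi x v m ->
  \forall y \near x, dir_le Phi y v m.
Proof.
move=> [r r0 H]; apply/nbhs_ballP; exists (r / 2); first by rewrite /= divr_gt0.
move=> y; rewrite -ball_normE /= => yr.
exists (r / 2); first by rewrite divr_gt0.
move=> w s wr /andP[s0 sr]; apply: H; last by rewrite s0; lra.
have -> : x - w = (x - y) + (y - w) by rewrite addrA subrK.
by apply: le_lt_trans (ler_normD _ _) _; lra.
Qed.

(** A negative derivative at [x] would give a fixed slope [m < 0] along [v] at all late [y n], while
    the slopes there have a lower bound tending to 0. *)
Lemma gen_dir_deriv_limit_ge0 {Phi x} {y : nat -> X} {e : nat -> R} :
  y n @[n --> \oo] --> x -> e n @[n --> \oo] --> (0 : R) ->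
  (forall n v m, dir_le Phi (y n) v m -> - e n * `|v| <= m) ->
  forall v, (0 <= gen_dir_deriv Phi x v)%E.
Proof.
move=> yx e0 H v; rewrite leNgt; apply/negP => vlt0.
have [m m0 Dm] := gen_dir_deriv_lt vlt0.
have : - e n * `|v| @[n --> \oo] --> (- 0 * `|v| : R).
  by apply: cvgMr_tmp; apply: cvgN.
rewrite oppr0 mul0r => /(cvgr_gt (0 : R)) /(_ _ m0) near_m.
have near_D : \forall n \near \oo, dir_le Phi (y n) v m.
  exact: (yx _ (dir_le_near Dm)).
have [n [nm nD]] := filter_ex (filterI near_m near_D).
by have := H _ _ _ nD; lra.
Qed.

Lemma dual_norm_ge0 (f : {linear X -> R^o}) : 0 <= dual_norm f.
Proof.
rewrite /dual_norm; set S := [set _ | _ in _].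
have [[_ ub]|/sup_out -> //] := pselect (has_sup S).
by apply: ub_le_sup => //; exists 0 => /=; rewrite ?linear0 normr0.
Qed.

Lemma min_gradient_norm_ge0 Phi x : 0 <= min_gradient_norm Phi x.
Proof.
rewrite /min_gradient_norm; set S := [set _ | _ in _].
have [->|/set0P S0] := eqVneq S set0; first by rewrite inf0.
by apply: lb_le_inf => // _ [f _ <-]; exact: dual_norm_ge0.
Qed.

(* The separating functional lies below the infimal convolution of the
   directional derivative with [k `|.|], which is finite and sublinear. *)
Lemma min_gradient_norm_le {Phi x k} :
  (forall v m, dir_le Phi x v m -> - k * `|v| <= m) -> 0 <= k ->
  min_gradient_norm Phi x <= k.
Proof.
move=> H k0.
pose S v := [set p.1 + k * `|v - p.2| | p in
  [set p : R * X | dir_le Phi x p.2 p.1]].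
have S0 v : S v !=set0.
  by exists (0 + k * `|v - 0|); exists (0, 0) => //; exact: dir_le0.
have Slb v : has_lbound (S v).
  exists (- k * `|v|) => _ [[m u] /= /H Hm <-].
  have : `|u| <= `|v| + `|v - u|.
    by have := ler_normB v (v - u); rewrite opprB addrCA subrr addr0.
  by move=> /(ler_wpM2l k0); rewrite mulrDr; lra.
pose q v := inf (S v).
have qle v m u : dir_le Phi x u m -> q v <= m + k * `|v - u|.
  by move=> D; apply: ge_inf => //; exists (m, u).
have sq : sublinear q.
  split=> [u w|a u a0].
    apply: le_inf_add => // _ _ [[m1 v1] /= D1 <-] [[m2 v2] /= D2 <-].
    apply: le_trans (qle _ _ _ (dir_leD D1 D2)) _.
    have : `|u + w - (v1 + v2)| <= `|u - v1| + `|w - v2|.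
      by rewrite opprD addrACA ler_normD.
    by move=> /(ler_wpM2l k0); rewrite mulrDr; lra.
  rewrite -ler_pdivrMl//; apply: lb_le_inf => // _ [[m1 v1] /= D1 <-].
  rewrite ler_pdivrMl//; apply: le_trans (qle _ _ _ (dir_leZ a0 D1)) _.
  by rewrite -scalerBr normrZ gtr0_norm// mulrDr mulrCA.
have [f fq] := hahn_banach_sublinear sq.
(* Comparison with the zero direction gives the norm bound, hence continuity; comparison with [v]
   itself later places [f] in the gradient. *)
have fk v : f v <= k * `|v|.
  apply: le_trans (fq v) _.
  by have := qle v 0 0 (dir_le0 _ _); rewrite add0r subr0.
have fabs v : `|f v| <= k * `|v|.
  rewrite ler_norml fk andbT.
  by have := fk (- v); rewrite linearN normrN /=; lra.
have fc : continuous f.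
  apply/bounded_linear_continuous/linear_boundedP.
  exists k; split; first exact: num_real.
  move=> M kM v; apply: le_trans (fabs v) _.
  by rewrite ler_wpM2r// ltW.
have fC : clarke_gradient Phi x f.
  split => // v; rewrite leNgt; apply/negP => /gen_dir_deriv_lt[m mf Dm].
  have := qle v m v Dm; rewrite subrr normr0 mulr0 addr0.
  by have := fq v; lra.
apply: (@le_trans _ _ (dual_norm f)).
  apply: ge_inf; last by exists f.
  exists 0 => _ [g _ <-]; exact: dual_norm_ge0.
apply: ge_sup; first by exists `|f 0|, 0 => //=; rewrite normr0.
move=> _ [z /= z1 <-]; apply: le_trans (fabs z) _.
by rewrite -[leRHS]mulr1 ler_wpM2l.
Qed.

End ClarkeGradient.

(** * The delta-distance *)

Section DeltaDistance.
Context {R : realType} {X : normedModType R}.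
Implicit Types (x y : X) (s t : R) (F : set X).

(** Makes limits of difference quotients unique at every time, endpoints included: a move of at most
    [1 / 2] away from the nearer endpoint stays in the interval. *)
Lemma within01_dnbhs_proper (t : R) : `[0, 1]%classic t ->
  ProperFilter (within `[0, 1] t^').
Proof.
rewrite /= in_itv/= => /andP[t0 t1].
apply: Build_ProperFilter => [] [e /= e0 H].
pose d := Num.min (e / 2) (1 / 2).
have d0 : 0 < d by rewrite lt_min !divr_gt0.
have [de d1] : d <= e / 2 /\ d <= 1 / 2.
  by split; rewrite ge_min lexx ?orbT.
have [th|th] := leP t (1 / 2).
- apply: (H (t + d)) => /=.
  + by rewrite opprD addrA subrr sub0r normrN gtr0_norm//; lra.
  + by rewrite -subr_eq0 addrAC subrr add0r gt_eqF.
  + by rewrite in_itv/=; apply/andP; split; lra.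
- apply: (H (t - d)) => /=.
  + by rewrite opprB addrCA subrr addr0 gtr0_norm//; lra.
  + by rewrite -subr_eq0 addrAC subrr add0r oppr_eq0 gt_eqF.
  + by rewrite in_itv/=; apply/andP; split; lra.
Qed.

Let line x y (t : R) : X := x + t *: (y - x).

Let line_diff_quotient x y t :
  diff_quotient01 (line x y) t --> y - x.
Proof.
apply: cvg_near_cst; exists 1 => //= s _ st _.
rewrite /line opprD addrACA subrr add0r -scalerBl scalerA mulVf ?scale1r//.
by rewrite subr_eq0.
Qed.

Let line_deriv01 x y t : `[0, 1]%classic t -> deriv01 (line x y) t = y - x.
Proof.
move=> t01; have PF := within01_dnbhs_proper _ t01.
by apply: cvg_lim => //; exact: line_diff_quotient.
Qed.

Lemma line_continuous x y : continuous (line x y).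
Proof.
move=> t; apply: cvgD; first exact: cvg_cst.
by apply: cvgZr_tmp; exact: cvg_id.
Qed.

Lemma delta_dist_ge0 x y : 0 <= delta_dist x y.
Proof.
rewrite /delta_dist; set S := [set _ | _ in _].
have [->|/set0P S0] := eqVneq S set0; first by rewrite inf0.
apply: lb_le_inf => // _ [c _ <-]; apply: Rintegral_ge0 => t _.
by rewrite divr_ge0// addr_ge0.
Qed.

(** The competitor is the segment. Its points are so close to [y] that one plus their norm is at
    least half of one plus the norm of [y], whence the factor 2. *)
Lemma delta_dist_le x y s : s <= 1 / 2 -> `|x - y| <= s * (1 + `|y|) ->
  delta_dist x y <= 2 * s.
Proof.
move=> s2 xys.
have line01 : C1_path (line x y).
  split=> [t _|]; first by apply/cvg_ex; exists (y - x); exact: line_diff_quotient.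
  apply: (@subspace_eq_continuous _ _ _ (cst (y - x))).
    by move=> t /set_mem t01; symmetry; exact: line_deriv01.
  exact/continuous_subspaceT/cst_continuous.
apply: (@le_trans _ _ (delta_length (line x y))).
  apply: ge_inf.
    exists 0 => _ [c _ <-]; apply: Rintegral_ge0 => t _.
    by rewrite divr_ge0// addr_ge0.
  exists (line x y) => //; split => //; rewrite /line ?scale0r ?addr0//.
  by rewrite scale1r addrC subrK.
have cf : continuous (fun t => `|y - x| / (1 + `|line x y t|)).
  move=> t; apply: cvgM; first exact: cvg_cst.
  apply: cvgV; first by rewrite gt_eqF// ltr_pwDl.
  apply: cvgD; first exact: cvg_cst.
  by apply: cvg_norm; exact: line_continuous.
have -> : delta_length (line x y) =
    \int[lebesgue_measure]_(t in `[0, 1]) (`|y - x| / (1 + `|line x y t|)).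
  by apply: eq_Rintegral => t /set_mem t01; rewrite line_deriv01.
apply: (@le_trans _ _ (\int[lebesgue_measure]_(t in `[0%R, 1%R]) (2 * s))%R).
  apply: le_Rintegral => //=.
  - apply: continuous_compact_integrable; first exact: segment_compact.
    exact: continuous_subspaceT.
  - apply: continuous_compact_integrable; first exact: segment_compact.
    exact/continuous_subspaceT/cst_continuous.
  move=> t; rewrite /= in_itv/= => /andP[t0 t1].
  rewrite ler_pdivrMr ?ltr_pwDl// distrC; apply: (le_trans xys).
  have s0 : 0 <= s.
    by rewrite -(pmulr_lge0 _ (_ : 0 < 1 + `|y|)) ?ltr_pwDl// (le_trans _ xys).
  have : `|y| <= `|line x y t| + `|x - y|.
    have yE : y - line x y t = (1 - t) *: (y - x).
      by rewrite scalerBl scale1r /line opprD addrA.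
    have : `|y - line x y t| <= `|x - y|.
      by rewrite yE normrZ ger0_norm ?subr_ge0// distrC ler_piMl// gerBl.
    by have := lerB_dist y (line x y t); lra.
  move=> /(ler_wpM2l s0) h1; have h2 := ler_wpM2l s0 xys.
  have h3 : s * (s * (1 + `|y|)) <= 1 / 2 * (s * (1 + `|y|)).
    by rewrite ler_wpM2r// mulr_ge0// addr_ge0.
  by lra.
by rewrite Rintegral_cst//= lebesgue_measure_itv/= lte_fin ltr01 oppr0
  adde0 /= mulr1.
Qed.

Lemma dist_delta_ge0 x F : (0 <= dist_delta x F)%E.
Proof.
by apply: le_ereal_inf_tmp => _ [y _ <-]; rewrite lee_fin delta_dist_ge0.
Qed.

Lemma dist_delta_le x y F s : F y -> s <= 1 / 2 ->
  `|x - y| <= s * (1 + `|y|) -> (dist_delta x F <= (2 * s)%:E)%E.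
Proof.
move=> Fy s2 xys; apply: (@le_trans _ _ (delta_dist x y)%:E).
  by apply: ereal_inf_lbound; exists y.
by rewrite lee_fin delta_dist_le.
Qed.

End DeltaDistance.

(** * Bump functions *)

Section Bump.
Context {R : realType} {X : normedModType R}.
Implicit Types (a x y z : X) (F : set X) (r c : R).

(* The bumps are 4-Lipschitz for the metric [|dx| / (1 + |x|)] at small scales,
   and a sequence that is Cauchy for all of them uniformly is norm-Cauchy: they
   replace the delta-distance as a complete metric. *)
Definition bump a x : R := Num.min 1 (`|x - a| / (1 + `|a|)).

Lemma bump_ge0 a x : 0 <= bump a x.
Proof. by rewrite le_min ler01 divr_ge0// addr_ge0. Qed.

Lemma bumpaa a : bump a a = 0.
Proof. by rewrite /bump subrr normr0 mul0r min_r. Qed.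

Lemma bump_lt {a x r} : bump a x < r -> r <= 1 -> `|x - a| < r * (1 + `|a|).
Proof.
by rewrite gt_min ltr_pdivrMr ?ltr_pwDl// => /orP[? ?|//]; lra.
Qed.

(** Where both quotients are at least 1 the bump is constant. Otherwise [x] is close enough to [a]
    that one plus its norm is at most 4 times one plus the norm of [a], which turns the Lipschitz
    constant at [a] into one at [x]. *)
Lemma bump_lipschitz a x z : `|z| <= (1 + `|x|) / 2 ->
  `|bump a (x + z) - bump a x| <= 4 * `|z| / (1 + `|x|).
Proof.
move=> zx; rewrite ler_pdivlMr ?ltr_pwDl//.
have N0 : 0 < 1 + `|a| by rewrite ltr_pwDl.
have uw : `| `|x + z - a| - `|x - a| | <= `|z|.
  have := ler_dist_dist (x + z - a) (x - a).
  by rewrite opprB addrA subrK (addrC x z) addrK.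
have xN : `|x| <= `|x - a| + `|a|.
  by have := ler_normD (x - a) a; rewrite subrK.
rewrite /bump; set p := `|x + z - a| / _; set q := `|x - a| / _.
have pN : `|x + z - a| = p * (1 + `|a|) by rewrite divfK ?gt_eqF.
have qN : `|x - a| = q * (1 + `|a|) by rewrite divfK ?gt_eqF.
have [/andP[p1 q1]|pq1] := boolP ((1 <= p) && (1 <= q)).
  by rewrite !min_l// subrr normr0 mul0r mulr_ge0.
have uwN : `|p - q| * (1 + `|a|) <= `|z|.
  by rewrite -[X in _ * X]gtr0_norm// -normrM mulrBl -pN -qN.
have minpq : `|Num.min 1 p - Num.min 1 q| <= `|p - q|.
  have := ler_norm (p - q); have := ler_norm (- (p - q)).
  rewrite normrN ler_norml /Order.min.
  by case: ltP => ?; case: ltP => ? ? ?; apply/andP; split; lra.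
have xN4 : 1 + `|x| <= 4 * (1 + `|a|).
  move: uw; rewrite ler_norml => /andP[uw1 uw2].
  move: pq1; rewrite negb_and -!ltNge !ltr_pdivrMr// !mul1r => /orP[]; lra.
have := ler_pM (normr_ge0 _) _ minpq xN4; rewrite addr_ge0// => /(_ isT).
by lra.
Qed.

(** A truncated relative distance to [F]. For empty [F] it is 0 by the convention on [inf], so
    positivity off [F] asks for a nonempty set. *)
Definition bump_dist F x : R := inf [set bump a x | a in F].

Lemma bump_dist_le F a x : F a -> bump_dist F x <= bump a x.
Proof.
move=> Fa; apply: ge_inf; last by exists a.
by exists 0 => _ [b _ <-]; exact: bump_ge0.
Qed.

Lemma bump_dist_ge0 F x : 0 <= bump_dist F x.
Proof.
rewrite /bump_dist; set S := [set _ | _ in _].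
have [->|/set0P S0] := eqVneq S set0; first by rewrite inf0.
by apply: lb_le_inf => // _ [a _ <-]; exact: bump_ge0.
Qed.

Lemma bump_dist_lt {F x r} : F !=set0 -> bump_dist F x < r ->
  exists2 a, F a & bump a x < r.
Proof.
move=> [b Fb] /inf_lt[|_ [a Fa <-] ?]; last by exists a.
by exists (bump b x), b.
Qed.

Lemma bump_dist_leD F x y c : F !=set0 ->
  (forall a, bump a y <= bump a x + c) ->
  bump_dist F y <= bump_dist F x + c.
Proof.
move=> [b Fb] H; rewrite -lerBlDr; apply: lb_le_inf; first by exists (bump b x), b.
move=> _ [a Fa <-]; rewrite lerBlDr; apply: le_trans (H a); exact: bump_dist_le.
Qed.

Lemma bump_dist_lipschitz F x z : F !=set0 -> `|z| <= (1 + `|x|) / 2 ->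
  `|bump_dist F (x + z) - bump_dist F x| <= 4 * `|z| / (1 + `|x|).
Proof.
move=> F0 zx; rewrite ler_norml; apply/andP; split.
  rewrite lerBrDl lerBlDr; apply: bump_dist_leD => // a.
  by have := bump_lipschitz a _ _ zx; rewrite ler_norml => /andP[]; lra.
rewrite lerBlDl; apply: bump_dist_leD => // a.
by have := bump_lipschitz a _ _ zx; rewrite ler_norml => /andP[]; lra.
Qed.

Lemma bump_dist_gt0 F x : F !=set0 -> closed F -> ~ F x -> 0 < bump_dist F x.
Proof.
move=> F0 cF nFx.
have [e /= e0 He] : exists2 e, 0 < e & forall a, `|x - a| < e -> ~ F a.
  have : nbhs x (~` F) by apply: open_nbhs_nbhs; split => //; exact: closed_openC.
  by move=> /nbhs_ballP[e e0 H]; exists e => // a; move: (H a); rewrite -ball_normE.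
(* A bump below [s <= 1 / 2] puts [a] within [2 * s] times one plus the norm of [x]; the factor 4
   makes this less than [e]. *)
pose d := e / (4 * (1 + `|x|)).
have x0 : 0 < 1 + `|x| by rewrite ltr_pwDl.
pose s := Num.min (1 / 2) d.
have s0 : 0 < s by rewrite lt_min !divr_gt0// mulr_gt0.
rewrite (lt_le_trans s0)// leNgt; apply/negP => /(bump_dist_lt F0)[a Fa /bump_lt].
have s2 : s <= 1 / 2 by rewrite ge_min lexx.
have sd : s * (4 * (1 + `|x|)) <= e.
  by rewrite -ler_pdivlMr ?mulr_gt0// ge_min lexx orbT.
move=> /(_ _)/wrap[|xa]; first by lra.
apply: (He a) => //; have : `|a| <= `|x| + `|x - a|.
  by have := ler_normB x (x - a); rewrite opprB addrCA subrr addr0.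
move: xa sd => + + /(ler_wpM2l (ltW s0)).
have : s * `|x - a| <= 1 / 2 * `|x - a| by rewrite ler_wpM2r.
by rewrite !mulrDr; lra.
Qed.

Lemma bump_dist_continuous F : F !=set0 -> continuous (bump_dist F).
Proof.
move=> F0 x; apply/cvgrPdist_le => /= e e0.
apply/nbhs_ballP; exists (Num.min (1 / 2) (e / 4)).
  by rewrite /= lt_min !divr_gt0.
move=> y; rewrite -ball_normE /= lt_min => /andP[xy1 xy2].
have xx : 1 <= 1 + `|x| by rewrite lerDl.
have := bump_dist_lipschitz F x (y - x) F0.
rewrite [x + _]addrC subrK [`|y - x|]distrC [`|bump_dist F y - _|]distrC.
move=> /(_ _)/wrap[|]; first by lra.
rewrite ler_pdivlMr; last by lra.
have : `|bump_dist F x - bump_dist F y| * 1 <=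
    `|bump_dist F x - bump_dist F y| * (1 + `|x|).
  by rewrite ler_wpM2l.
by lra.
Qed.

End Bump.

(** * Pseudo-gradients *)

Section PseudoGradient.
Context {R : realType} {X : normedModType R}.
Context (Phi : X -> R) (k : R).

(** A patch [(y, v, r)] is a centre, a descent direction and a radius. Descent is required on twice
    the radius, so that points of the [r]-ball may first be displaced by up to [r]. *)
Let patch (p : X * X * R) := [/\ 0 < p.2 <= 1 / 2, `|p.1.2| <= 1 + `|p.1.1| &
  forall w s, `|p.1.1 - w| < 2 * p.2 -> 0 < s < 2 * p.2 ->
    Phi (w + s *: p.1.2) - Phi w <= s * - k].

(** [V] will be a sum of directions weighted by tent functions and [sigma] the sum of the weights.
    The factor 2 compares the norms at [x] and at the centre of a patch of radius at most
    [1 / 2]. *)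
Let descends (V : X -> X) (sigma : X -> R) (h : R) :=
  [/\ continuous V, continuous sigma, 0 < h, forall x, 0 <= sigma x &
   forall x, `|V x| <= 2 * sigma x * (1 + `|x|) /\
     forall s, 0 <= s <= h -> Phi (x + s *: V x) - Phi x <= s * sigma x * - k].

(* The decrease along a sum of small steps is additive since each step stays in
   the ball where the next direction is a descent direction. *)
Let descends_patches (l : seq (X * X * R)) : (forall p, p \in l -> patch p) ->
  exists V sigma h B, [/\ descends V sigma h, forall x, `|V x| <= B &
    forall p x, p \in l -> `|p.1.1 - x| < p.2 -> 0 < sigma x].
Proof.
elim: l => [_|[[y v] r] l IH Hl].
  exists (cst 0), (cst 0), 1, 0; split=> [|x|//]; last by rewrite normr0.
  split=> // [||x]; [exact: cst_continuous|exact: cst_continuous|].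
  split=> [|s _]; first by rewrite normr0 mulr0 mul0r.
  by rewrite scaler0 addr0 subrr mulr0 mul0r.
have [|V [sigma [h [B [[Vc sc h0 s0 H] VB Hs]]]]] := IH.
  by move=> p pl; apply: Hl; rewrite in_cons pl orbT.
have [/= /andP[r0 r2] vy Hv] := Hl (y, v, r) (mem_head _ _).
pose lam x := Num.max 0 (r - `|y - x|).
have lamc : continuous lam.
  move=> x; apply: (@continuous_max _ _ (cst 0) (fun x => r - `|y - x|)).
    exact: cvg_cst.
  apply: cvgB; first exact: cvg_cst.
  by apply: cvg_norm; apply: cvgB; [exact: cvg_cst|exact: cvg_id].
have lam0 x : 0 <= lam x by rewrite le_max lexx.
have lamr x : lam x <= r by rewrite ge_max (ltW r0) gerBl /=.
have lam_gt0 x : 0 < lam x -> `|y - x| < r.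
  by rewrite lt_max ltxx /= subr_gt0.
have B0 : 0 <= B by exact: le_trans (normr_ge0 _) (VB 0).
(* The bound [r / (1 + B)] limits the displacement by the earlier directions to [r]; the bound 1
   keeps the new step [s * lam x] within [r]. *)
exists (fun x => V x + lam x *: v), (fun x => sigma x + lam x),
  (Num.min h (Num.min 1 (r / (1 + B)))), (B + r * `|v|).
split; [split| |].
- by move=> x; apply: cvgD; [exact: Vc|apply: cvgZr_tmp; exact: lamc].
- by move=> x; apply: cvgD; [exact: sc|exact: lamc].
- by rewrite !lt_min h0 ltr01 divr_gt0// ltr_pwDl.
- by move=> x; rewrite addr_ge0.
- move=> x; have [Vx Dx] := H x; have := lam0 x.
  rewrite le_eqVlt => /predU1P[lamx0|lamx0].
    rewrite -lamx0 scale0r !addr0; split => // s /andP[s_ge0].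
    by rewrite le_min => /andP[sh _]; apply: Dx; rewrite s_ge0.
  have yx := lam_gt0 _ lamx0; split.
    apply: le_trans (ler_normD _ _) _; rewrite normrZ (gtr0_norm lamx0).
    have -> : 2 * (sigma x + lam x) * (1 + `|x|) =
        2 * sigma x * (1 + `|x|) + lam x * (2 * (1 + `|x|)) by ring.
    rewrite lerD// ler_wpM2l//.
    apply: le_trans vy _.
    have : `|y| <= `|x| + `|y - x|.
      by have := ler_normD (y - x) x; rewrite subrK addrC.
    have := normr_ge0 x; lra.
  move=> s /andP[]; rewrite le_eqVlt => /predU1P[<-|s_gt0].
    by rewrite !scale0r addr0 subrr !mul0r.
  rewrite !le_min => /and3P[sh s1 sr].
  have := Dx s; rewrite (ltW s_gt0) sh => /(_ isT).
  have := Hv (x + s *: V x) (s * lam x).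
  rewrite -addrA scalerDr scalerA => H1 H2.
  have : Phi (x + (s *: V x + (s * lam x) *: v)) - Phi (x + s *: V x) <=
      s * lam x * - k.
    apply: H1.
      rewrite opprD addrA; apply: le_lt_trans (ler_normB _ _) _.
      rewrite normrZ gtr0_norm//.
      have : s * `|V x| <= s * (1 + B).
        by rewrite ler_pM2l// (le_trans (VB x))// lerDr.
      by move: sr; rewrite ler_pdivlMr ?ltr_pwDl//; lra.
    rewrite mulr_gt0//=.
    have : s * lam x <= 1 * r by rewrite ler_pM// ltW.
    by lra.
  by lra.
- move=> x; apply: le_trans (ler_normD _ _) _; rewrite lerD// normrZ ger0_norm//.
  by rewrite ler_wpM2r.
- move=> p x; rewrite in_cons => /predU1P[->/= yx|pl px].
    by rewrite ltr_wpDl// lt_max subr_gt0 yx orbT.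
  by rewrite ltr_pwDl// (Hs p).
Qed.

(** Finitely many patches cover [K], and the total weight [sigma] is positive wherever one of them
    is active. *)
Lemma pseudo_gradient (K : set X) : compact K ->
  (forall x, K x -> exists2 v, `|v| <= 1 + `|x| & dir_le Phi x v (- k)) ->
  exists (V : X -> X) (sigma : X -> R) (h : R),
  [/\ continuous V, continuous sigma, 0 < h, forall x, 0 <= sigma x &
   forall x, `|V x| <= 2 * sigma x * (1 + `|x|) /\
     forall s, 0 <= s <= h -> Phi (x + s *: V x) - Phi x <= s * sigma x * - k]
  /\ forall x, K x -> 0 < sigma x.
Proof.
move=> + HK; rewrite compact_cover.
move=> /(_ _ patch (fun p => ball p.1.1 p.2))[||D Dpatch KD].
- by move=> p [/andP[p0 _] _ _]; exact: ball_open.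
- move=> x Kx; have [v vx [r r0 Hr]] := HK x Kx.
  have r'0 : 0 < Num.min (r / 2) (1 / 2) by rewrite lt_min !divr_gt0.
  exists (x, v, Num.min (r / 2) (1 / 2)); last exact: ballxx.
  have rr : 2 * Num.min (r / 2) (1 / 2) <= r.
    by rewrite -ler_pdivlMl// mulrC ge_min lexx.
  split => //=; first by rewrite r'0 ge_min lexx orbT.
  move=> w s ws /andP[s0 sr]; apply: Hr; first exact: lt_le_trans ws rr.
  by rewrite s0 (lt_le_trans sr rr).
have [|V [sigma [h [B [HV _ Hs]]]]] := @descends_patches (finmap.enum_fset D).
  by move=> p pD; apply: set_mem; exact: Dpatch.
exists V, sigma, h; split => // x /KD[p pD].
by rewrite -ball_normE /= => px; exact: Hs px.
Qed.

End PseudoGradient.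

(** * Minimal paths *)

Section Minimality.
Context {R : realType}.

(* Brezis-Browder ordering principle *)
Lemma exists_order_minimal (T : Type) (below : T -> T -> Prop) (f : T -> R)
    (b : R) (x0 : T) :
  (forall x, below x x) ->
  (forall x y z, below x y -> below y z -> below x z) ->
  (forall x y, below x y -> f x <= f y) -> (forall x, b <= f x) ->
  (forall u : nat -> T, (forall n, below (u n.+1) (u n)) ->
    exists x, forall n, below x (u n)) ->
  exists2 x, below x x0 & forall y, below y x -> f y = f x.
Proof.
move=> bxx btrans bf fb blim.
pose S x := [set f y | y in below^~ x].
have S0 x : S x !=set0 by exists (f x), x.
have Slb x : has_lbound (S x) by exists b => _ [y _ <-].
(* [next x] closes at least half of the gap between [f x] and any value below [x]. *)
have [x|next Hnext] := @choice _ _ (fun x y => below y x /\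
    forall z, below z x -> f y <= (f x + f z) / 2).
  have [fx|fx] := leP (f x) (inf (S x)).
    exists x; split => // z zx.
    have : inf (S x) <= f z by apply: ge_inf => //; exists z.
    by lra.
  have : inf (S x) < (f x + inf (S x)) / 2 by lra.
  move=> /(inf_lt (S0 x))[_ [y yx <-] fy]; exists y; split => // z zx.
  have : inf (S x) <= f z by apply: ge_inf => //; exists z.
  by lra.
pose u n := iter n next x0.
have [x xu] : exists x, forall n, below x (u n).
  by apply: blim => n; exact: (Hnext (u n)).1.
exists x => [|y yx]; first exact: xu 0%N.
(* For [y] below [x], the halving gives [2 * L - f y <= L], so that [f y >= L >= f x]. *)
pose L := inf (range (f \o u)).
have Llb : has_lbound (range (f \o u)) by exists b => _ [n _ <-] /=.
have Rn0 : range (f \o u) !=set0 by exists (f (u 0%N)), 0%N.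
have xL : f x <= L by apply: lb_le_inf => // _ [n _ <-]; exact/bf/xu.
have Ly : 2 * L - f y <= L.
  apply: lb_le_inf => // _ [n _ <-] /=.
  have : L <= f (u n.+1) by apply: ge_inf => //; exists n.+1.
  have := (Hnext (u n)).2 _ (btrans _ _ _ yx (xu n)).
  rewrite -[f (next _)]/(f (u n.+1)); lra.
by have := bf _ _ yx; apply: contraPeq; lra.
Qed.

End Minimality.

(** * Heights and limits of paths *)

Section Paths.
Context {R : realType} {X : completeNormedModType R}.
Local Notation A := (`[0, 1]%classic : set R).

Lemma path_height {G : X -> R} {c : R -> X} : continuous G ->
  {within A, continuous c} -> exists2 t, A t &
    sup [set G (c s) | s in A] = G (c t) /\ forall s, A s -> G (c s) <= G (c t).
Proof.
move=> Gc cc.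
have Gcc : {within A, continuous (G \o c)}.
  apply/subspace_continuousP => t At.
  by apply: continuous_cvg; [exact: Gc|move/subspace_continuousP: cc; exact].
have [t t01 Ht] := EVT_max (@ler01 R) Gcc.
have Hs s : A s -> G (c s) <= G (c t) by move=> s01; exact: Ht.
exists t => //; split => //; apply/eqP; rewrite eq_le; apply/andP; split.
  by apply: ge_sup; [exists (G (c t)), t|move=> _ [s /Hs ? <-]].
by apply: ub_le_sup; [exists (G (c t)) => _ [s /Hs ? <-]|exists t].
Qed.

Lemma path_sup {G : X -> R} {c : R -> X} : continuous G ->
  {within A, continuous c} -> forall s, A s -> G (c s) <= sup [set G (c s) | s in A].
Proof. by move=> Gc cc; have [t _ [->]] := path_height Gc cc. Qed.

(** The bump centred at [c n t] itself bounds the relative distance from [c n t] to later points.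
    One path being bounded, all later ones are, so relative closeness becomes uniform closeness in
    norm and completeness applies. *)
Lemma bump_cauchy_path {c : nat -> R -> X} {J : nat -> R} {b : R} :
  (forall n, {within A, continuous (c n)}) -> (forall n, b <= J n) ->
  (forall n m, (n <= m)%N -> forall t a, A t ->
     `|bump a (c m t) - bump a (c n t)| <= J n - J m) ->
  exists2 c', {within A, continuous c'} &
    forall t, A t -> c n t @[n --> \oo] --> c' t.
Proof.
move=> cc bJ H.
have A0 : A 0 by rewrite /= in_itv/= lexx ler01.
have Jle n m : (n <= m)%N -> J m <= J n.
  by move=> nm; have := le_trans (normr_ge0 _) (H _ _ nm 0 0 A0); rewrite subr_ge0.
pose L := inf (range J).
have LJ n : L <= J n by apply: ge_inf; [exists b => _ [m _ <-]|exists n].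
have JL e : 0 < e -> exists n, J n - L < e.
  move=> e0; have : L < L + e by lra.
  move=> /inf_lt[|_ [n _ <-] ?]; first by exists (J 0%N), 0%N.
  by exists n; lra.
have close n m r t : (n <= m)%N -> J n - L < r -> r <= 1 -> A t ->
    `|c m t - c n t| < r * (1 + `|c n t|).
  move=> nm Jr r1 t01; apply: bump_lt r1.
  have := H _ _ nm t (c n t) t01; rewrite bumpaa subr0 ger0_norm ?bump_ge0//.
  by have := LJ m; lra.
have [N JN] := JL 1 ltr01.
have [t0 _ [_ cNb]] := path_height (@norm_continuous _ X) (cc N).
pose B := 1 + 2 * `|c N t0|.
have cB n t : (N <= n)%N -> A t -> `|c n t| <= B.
  move=> Nn t01; have := close _ _ _ t Nn JN (lexx _) t01.
  have := ler_normD (c n t - c N t) (c N t); rewrite subrK mul1r.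
  by have := cNb t t01; rewrite /B; lra.
have B0 : 0 < 1 + B by have := normr_ge0 (c N t0); rewrite /B; lra.
have U e : 0 < e -> exists n, forall m t, (n <= m)%N -> A t ->
    `|c m t - c n t| < e.
  move=> e0; pose r := Num.min 1 (e / (1 + B)).
  have r0 : 0 < r by rewrite lt_min ltr01 divr_gt0.
  have r1 : r <= 1 by rewrite ge_min lexx.
  have re : r <= e / (1 + B) by rewrite ge_min lexx orbT.
  have [k Jk] := JL _ r0; exists (maxn N k) => m t nm t01.
  have Jr : J (maxn N k) - L < r.
    by apply: le_lt_trans Jk; rewrite lerD2r Jle ?leq_maxr.
  apply: lt_le_trans (close _ _ _ t nm Jr r1 t01) _.
  apply: (@le_trans _ _ (e / (1 + B) * (1 + B))); last by rewrite divfK ?gt_eqF.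
  by rewrite ler_pM ?(ltW r0) ?addr_ge0// lerD2l cB ?leq_maxl.
have ccvg t : A t -> cvg (c n t @[n --> \oo]).
  move=> t01; apply/cauchy_cvgP/cauchy_exP => e e0.
  have [n Hn] := U _ e0; exists (c n t), n => // m nm /=.
  by rewrite -ball_normE /= distrC; exact: Hn.
pose c' t := lim (c n t @[n --> \oo]).
have c'cvg t : A t -> c n t @[n --> \oo] --> c' t by move=> /ccvg.
exists c' => //.
have U' e : 0 < e -> exists n, forall t, A t -> `|c' t - c n t| <= e.
  move=> e0; have [n Hn] := U _ e0; exists n => t t01.
  have : `|c m t - c n t| @[m --> \oo] --> `|c' t - c n t|.
    by apply: cvg_norm; apply: cvgB; [exact: c'cvg|exact: cvg_cst].
  move=> /cvgr_to_le; apply; exists n => // m nm.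
  by apply/ltW/Hn.
apply/subspace_continuousP => t t01; apply/cvgrPdist_le => e e0.
have e3 : 0 < e / 3 by rewrite divr_gt0.
have [n Hn] := U' _ e3.
have /subspace_continuousP/(_ t t01)/cvgrPdist_le/(_ _ e3) := cc n.
apply: filter_app; apply: filter_app (withinT _ _); near=> s => As cts.
have -> : c' t - c' s = (c' t - c n t) + (c n t - c n s) - (c' s - c n s).
  by rewrite opprB !subrKA.
apply: le_trans (ler_normB _ _) _.
have := ler_normD (c' t - c n t) (c n t - c n s).
have := Hn _ t01; have := Hn _ As; move: cts; lra.
Unshelve. all: by end_near.
Qed.

End Paths.

(** * Ekeland's principle and deformation of paths *)

Section MinimaxPaths.
Context {R : realType} {X : completeNormedModType R}.
Local Notation A := (`[0, 1]%classic : set R).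
Local Notation height G c := (sup [set G (c t) | t in A]).

Lemma bump_continuous (a : X) : continuous (@bump R X a).
Proof.
move=> x; apply: (@continuous_min _ _ (cst 1) (fun x => `|x - a| / (1 + `|a|))).
  exact: cvg_cst.
apply: cvgMr_tmp; apply: cvg_norm; apply: cvgB; [exact: cvg_id|exact: cvg_cst].
Qed.

(* Ekeland's principle for paths that agree with [c0] on the set [Z] of times *)
Lemma exists_minimal_path {G : X -> R} {c0 : R -> X} (Z : set R) {e b : R} :
  continuous G -> {within A, continuous c0} -> 0 < e ->
  (forall c : R -> X, {within A, continuous c} ->
     (forall t, A t -> Z t -> c t = c0 t) -> b <= height G c) ->
  exists c : R -> X, [/\ {within A, continuous c},
    forall t, A t -> Z t -> c t = c0 t,
    forall t a, A t ->
      e * `|bump a (c t) - bump a (c0 t)| <= height G c0 - height G c &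
    forall c' : R -> X, {within A, continuous c'} ->
      (forall t, A t -> Z t -> c' t = c t) ->
      (forall t a, A t ->
        e * `|bump a (c' t) - bump a (c t)| <= height G c - height G c') ->
      height G c' = height G c].
Proof.
move=> Gc c0c e0 bH.
have A0 : A 0 by rewrite /= in_itv/= lexx ler01.
pose T := {c : R -> X | {within A, continuous c} /\
  forall t, A t -> Z t -> c t = c0 t}.
pose J (c : T) := height G (sval c).
pose below (c' c : T) := forall t a, A t ->
  e * `|bump a (sval c' t) - bump a (sval c t)| <= J c - J c'.
pose c0T : T := exist _ c0 (conj c0c (fun _ _ _ => erefl)).
have bxx c : below c c by move=> t a _; rewrite !subrr normr0 mulr0.
have btrans x y z : below x y -> below y z -> below x z.
  move=> xy yz t a At; have := xy t a At; have := yz t a At.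
  have : e * `|bump a (sval x t) - bump a (sval z t)| <=
    e * (`|bump a (sval x t) - bump a (sval y t)| +
         `|bump a (sval y t) - bump a (sval z t)|).
    by rewrite ler_pM2l// ler_distD.
  by rewrite mulrDr; lra.
have bJ x y : below x y -> J x <= J y.
  move=> /(_ 0 0 A0); have := normr_ge0 (bump 0 (sval x 0) - bump 0 (sval y 0)).
  by move=> /(mulr_ge0 (ltW e0)); lra.
have [||c cc0 cmin] := @exists_order_minimal R T below J b c0T bxx btrans bJ.
- by move=> [c [cc cZ]]; exact: bH.
- move=> u ubelow.
  have unm n m : (n <= m)%N -> below (u m) (u n).
    move=> /subnK <-; elim: (m - n)%N => [|i IHi]; first exact: bxx.
    by rewrite addSn; apply: btrans IHi; exact: ubelow.
  have ucont n : {within A, continuous (sval (u n))} by exact: (svalP (u n)).1.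
  have [|n m nm t a At|c cc uc] :=
    @bump_cauchy_path R X (fun n => sval (u n)) (fun n => J (u n) / e) (b / e) ucont.
  - move=> n; rewrite ler_pM2r ?invr_gt0//; apply: bH => //.
    exact: (svalP (u n)).2.
  - by rewrite -mulrBl ler_pdivlMr// mulrC; exact: unm.
  have cZ t : A t -> Z t -> c t = c0 t.
    move=> At Zt; apply: cvg_unique (uc t At) _ => //.
    rewrite (_ : (fun n => _) = cst (c0 t)); first exact: cvg_cst.
    by apply/funext => n; exact: (svalP (u n)).2.
  pose cT : T := exist _ c (conj cc cZ).
  exists cT => n.
  (* The height is lower semicontinuous: each [G (c t)] is a limit of values eventually below the
     height of [u m]. *)
  have JcT m : J cT <= J (u m).
    apply: ge_sup; first by exists (G (c 0)), 0.
    move=> _ [t At <-].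
    have : G (sval (u k) t) @[k --> \oo] --> G (c t).
      by apply: continuous_cvg; [exact: Gc|exact: uc].
    move=> /cvgr_to_le; apply; exists m => // k mk.
    by apply: le_trans (bJ _ _ (unm _ _ mk)); exact: path_sup.
  move=> t a At.
  have : e * `|bump a (sval (u k) t) - bump a (sval (u n) t)| @[k --> \oo] -->
      e * `|bump a (c t) - bump a (sval (u n) t)|.
    apply: cvgMl_tmp; apply: cvg_norm; apply: cvgB; last exact: cvg_cst.
    by apply: continuous_cvg; [exact: bump_continuous|exact: uc].
  move=> /cvgr_to_le; apply; exists n => // k nk.
  by apply: le_trans (unm _ _ nk t a At) _; rewrite lerD2l lerN2.
exists (sval c); split.
- exact: (svalP c).1.
- exact: (svalP c).2.
- exact: cc0.
- move=> c' c'c c'Z c'below.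
  have c'0 t : A t -> Z t -> c' t = c0 t.
    by move=> At Zt; rewrite c'Z//; exact: (svalP c).2.
  exact: (cmin (exist _ c' (conj c'c c'0))).
Qed.

(** Points move along a pseudo-gradient field for the maximum points, at a rate cut off by [chi].
    The slope [32 * e] of [Phi] outweighs the change of the penalty, at rate at most [8 * e]; half
    of the remaining [24 * e] is guaranteed. *)
Lemma path_deformation {Phi : X -> R} {F : set X} {e : R} {c : R -> X}
    {chi : R -> R} (G := fun x => Phi x - e * bump_dist F x) :
  continuous Phi -> F !=set0 -> 0 < e -> {within A, continuous c} ->
  {within A, continuous chi} -> (forall t, A t -> 0 <= chi t <= 1) ->
  (forall t, A t -> G (c t) = height G c -> 0 < chi t /\
    exists2 v, `|v| <= 1 + `|c t| & dir_le Phi (c t) v (- (32 * e))) ->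
  exists (c' : R -> X) (h : R),
    [/\ {within A, continuous c'}, forall t, chi t = 0 -> c' t = c t, 0 < h,
     forall t, A t -> G (c' t) <= height G c - 12 * e * h &
     forall t a, A t -> `|bump a (c' t) - bump a (c t)| <= 8 * h].
Proof.
move=> Phic F0 e0 cc chic chi01 Hmax.
have thc := bump_dist_continuous _ F0.
have Gc : continuous G.
  by move=> x; apply: cvgB; [exact: Phic|apply: cvgMl_tmp; exact: thc].
have Jmax := path_sup Gc cc; set J := height G c in Hmax Jmax *.
pose K := (c @` A) `&` [set x | J <= G x].
have Kc : compact K.
  apply: compact_closedI.
    by apply: continuous_compact => //; exact: segment_compact.
  rewrite (_ : [set x | J <= G x] = G @^-1` [set r | J <= r])//.
  by apply: closed_comp; [move=> x _; exact: Gc|exact: closed_ge].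
have KG t : A t -> G (c t) = J -> K (c t).
  by move=> At GJ; split; [exists t|rewrite /= GJ].
have [|V [sigma [h0 [[Vc sc h00 s0 HV] sK]]]] := pseudo_gradient Phi (32 * e) K Kc.
  move=> _ [[t At <-] /= JG]; apply: (Hmax t At _).2.
  by apply/eqP; rewrite eq_le JG Jmax.
pose u t := J - G (c t).
(* Positive everywhere: at maximum points through [chi] and [sigma], elsewhere through the gap
   [u]. *)
pose den t := chi t * sigma (c t) + u t.
have u0 t : A t -> 0 <= u t by move=> At; rewrite subr_ge0 Jmax.
have cs0 t : A t -> 0 <= chi t * sigma (c t).
  by move=> At; rewrite mulr_ge0//; have /andP[] := chi01 t At.
have den0 t : A t -> 0 < den t.
  move=> At; have := u0 t At; rewrite le_eqVlt => /predU1P[ut0|ut0].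
    have GJ : G (c t) = J by move: ut0; rewrite /u; lra.
    rewrite /den -ut0 addr0 mulr_gt0//; first exact: (Hmax t At GJ).1.
    exact/sK/KG.
  by rewrite ltr_wpDl// cs0.
have ccP t : A t -> c @ within A (nbhs t) --> c t.
  by move/subspace_continuousP : cc; exact.
have chicP t : A t -> chi @ within A (nbhs t) --> chi t.
  by move/subspace_continuousP : chic; exact.
have dencP t : A t -> den @ within A (nbhs t) --> den t.
  move=> At; apply: cvgD.
    apply: cvgM; first exact: chicP.
    by apply: continuous_cvg; [exact: sc|exact: ccP].
  apply: cvgB; first exact: cvg_cst.
  by apply: continuous_cvg; [exact: Gc|exact: ccP].
have denc : {within A, continuous den} by apply/subspace_continuousP.
have [t0 At0 Hd] := EVT_min (@ler01 R) denc.
set d := den t0 in Hd; have d0 : 0 < d by apply: den0.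
have dden t : A t -> d <= den t by move=> At; exact: Hd.
(* The three bounds keep the step in the range of the field, the displacement in the range of
   [bump_lipschitz], and [12 * e * h] below half of [den]. *)
pose h := Num.min (h0 * d) (Num.min (1 / 4) (d / (24 * e))).
have h_gt0 : 0 < h by rewrite !lt_min !mulr_gt0 ?divr_gt0 ?invr_gt0 ?mulr_gt0.
have hh0 : h <= h0 * d by rewrite ge_min lexx.
have h4 : h <= 1 / 4 by rewrite !ge_min lexx orbT.
have hd : h * (24 * e) <= d by rewrite -ler_pdivlMr ?mulr_gt0// !ge_min lexx !orbT.
pose c' t := c t + (h * (chi t / den t)) *: V (c t).
pose L t := chi t * sigma (c t) / den t.
have L0 t : A t -> 0 <= L t by move=> At; rewrite divr_ge0 ?cs0 ?ltW ?den0.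
have L1 t : A t -> L t <= 1.
  by move=> At; rewrite ler_pdivrMr ?den0// mul1r lerDl u0.
have step t : A t -> 0 <= h * (chi t / den t) <= h0.
  move=> At; have /andP[c0 c1] := chi01 t At; have dt := den0 t At.
  have -> /= : 0 <= h * (chi t / den t).
    by rewrite mulr_ge0 ?divr_ge0// ltW.
  rewrite mulrA ler_pdivrMr//.
  have : h * chi t <= h * 1 by rewrite ler_pM2l.
  have : h0 * d <= h0 * den t by rewrite ler_pM2l// dden.
  by lra.
have stepL t : h * (chi t / den t) * sigma (c t) = h * L t.
  by rewrite /L; ring.
have moved t : A t -> `|(h * (chi t / den t)) *: V (c t)| <=
    2 * (h * L t) * (1 + `|c t|).
  move=> At; have /andP[s_ge0 _] := step t At.
  rewrite normrZ ger0_norm// -stepL.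
  by have := ler_wpM2l s_ge0 (HV (c t)).1; lra.
have small t : A t -> `|(h * (chi t / den t)) *: V (c t)| <= (1 + `|c t|) / 2.
  move=> At; apply: le_trans (moved t At) _.
  have : h * L t <= 1 / 4 * 1 by rewrite ler_pM// ?L0 ?L1// ltW.
  by move=> hL; rewrite mulrC ler_wpM2l//; lra.
have lip t : A t ->
    4 * `|(h * (chi t / den t)) *: V (c t)| / (1 + `|c t|) <= 8 * (h * L t).
  move=> At; rewrite ler_pdivrMr ?ltr_pwDl//.
  by have := moved t At; lra.
exists c', h; split => //.
- apply/subspace_continuousP => t At; apply: cvgD; first exact: ccP.
  apply: cvgZ; last by apply: continuous_cvg; [exact: Vc|exact: ccP].
  apply: cvgMl_tmp; apply: cvgM; first exact: chicP.
  by apply: cvgV; [rewrite gt_eqF ?den0|exact: dencP].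
- by move=> t chit; rewrite /c' chit mul0r mulr0 scale0r addr0.
- move=> t At.
  have PhiD := (HV (c t)).2 _ (step t At); rewrite stepL in PhiD.
  have := le_trans (bump_dist_lipschitz F _ _ F0 (small t At)) (lip t At).
  rewrite ler_norml => /andP[thD _].
  have {}thD := ler_wpM2l (ltW e0) thD.
  have GD : G (c' t) <= G (c t) - 24 * (e * (h * L t)).
    by rewrite /G /c'; lra.
  have ehL : 0 <= e * (h * L t).
    by apply: mulr_ge0 (ltW e0) _; apply: mulr_ge0 (ltW h_gt0) _; exact: L0.
  (* Either the field carries at least half of [den] and the descent suffices, or the gap does and
     the point was already low enough. *)
  have [ucs|ucs] := leP (u t) (chi t * sigma (c t)).
    have L2 : 1 / 2 <= L t.
      by rewrite ler_pdivlMr ?den0// /den; lra.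
    have : e * (h * (1 / 2)) <= e * (h * L t) by rewrite !ler_pM2l.
    by have := u0 t At; rewrite /u; lra.
  have := dden t At; rewrite /den.
  by move: ucs; rewrite /u; lra.
- move=> t a At; apply: le_trans (bump_lipschitz a _ _ (small t At)) _.
  apply: le_trans (lip t At) _.
  have : h * L t <= h * 1 by rewrite ler_pM2l// L1.
  by lra.
Qed.

End MinimaxPaths.

(** * Almost critical points *)

Section NearCritical.
Context {R : realType} {X : completeNormedModType R}.
Context (Phi : X -> R) (z0 z1 : X) (F : set X).
Local Notation A := (`[0, 1]%classic : set R).
Local Notation gamma := (minimax_value Phi z0 z1).
Context (Phic : continuous Phi).

Let A0 : A 0. Proof. by rewrite /= in_itv/= lexx ler01. Qed.
Let A1 : A 1. Proof. by rewrite /= in_itv/= ler01 lexx. Qed.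

Let levels : set R := [set sup [set Phi (c t) | t in A] | c in C0_paths z0 z1].

Let levels_neq0 : levels !=set0.
Proof.
pose c (t : R) := z0 + t *: (z1 - z0).
exists (sup [set Phi (c t) | t in A]), c => //; split.
- by apply: continuous_subspaceT; exact: line_continuous.
- by rewrite /c scale0r addr0.
- by rewrite /c scale1r addrC subrK.
Qed.

Let le_level c t : C0_paths z0 z1 c -> A t ->
  Phi (c t) <= sup [set Phi (c t) | t in A].
Proof. by move=> [cc _ _]; exact: path_sup. Qed.

Lemma minimax_value_ge_start : Phi z0 <= gamma.
Proof.
apply: lb_le_inf => [|_ [c cP <-]]; first exact: levels_neq0.
by have [_ <- _] := cP; exact: le_level.
Qed.

Lemma minimax_value_ge_end : Phi z1 <= gamma.
Proof.
apply: lb_le_inf => [|_ [c cP <-]]; first exact: levels_neq0.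
by have [_ _ <-] := cP; exact: le_level.
Qed.

Lemma minimax_value_adherent {e : R} : 0 < e ->
  exists2 c, C0_paths z0 z1 c & forall t, A t -> Phi (c t) < gamma + e.
Proof.
move=> e0; have [|_ [c cP <-] ce] := @inf_lt R levels (gamma + e) levels_neq0.
  by rewrite ltrDl.
by exists c => // t At; apply: le_lt_trans ce; exact: le_level.
Qed.

Lemma path_meets_separator (H : set X) (c : R -> X) :
  separates H z0 z1 -> C0_paths z0 z1 c -> exists2 t, A t & H (c t).
Proof.
move=> [_ _ _ sep] [cc c0 c1]; apply: contrapT => nH; apply: sep.
apply: same_connected_component.
have cH : c @` A `<=` ~` H by move=> _ [t At <-] Ht; apply: nH; exists t.
apply: (connected_component_max _ cH); last by exists 1.
  by exists 0.
by apply: connected_continuous_connected => //; exact: segment_connected.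
Qed.

(* The penalty [- e * bump_dist F] makes the maximum of a nearly optimal path be
   attained near [F]; freezing the path where it is far from [F] keeps it so
   along the minimization. *)
Lemma near_critical_point (e : R) : closed F ->
  separates (F `&` [set x | gamma <= Phi x]) z0 z1 -> 0 < e <= 1 ->
  exists x, [/\ gamma <= Phi x <= gamma + 3 * e ^+ 2, bump_dist F x < 2 * e &
    forall v m, dir_le Phi x v m -> - (32 * e / (1 + `|x|)) * `|v| <= m].
Proof.
move=> cF sep /andP[e0 e1].
have e20 : 0 < e ^+ 2 by rewrite exprn_gt0.
have meets c : C0_paths z0 z1 c -> exists2 t, A t & F (c t) /\ gamma <= Phi (c t).
  exact: path_meets_separator sep.
have [c0 c0P c0_lt] := minimax_value_adherent e20.
have [c0c c00 c01] := c0P.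
have F0 : F !=set0 by have [t _ [Ft _]] := meets _ c0P; exists (c0 t).
pose G x := Phi x - e * bump_dist F x.
have thc := bump_dist_continuous _ F0.
have Gc : continuous G.
  by move=> x; apply: cvgB; [exact: Phic|apply: cvgMl_tmp; exact: thc].
have GPhi x : G x <= Phi x by rewrite gerBl mulr_ge0 ?bump_dist_ge0// ltW.
(* At an endpoint [Phi] is at most [gamma]; in case of equality the endpoint lies off the closed set
   [F], where the penalty is strictly positive. *)
have endpoint z : ~ (F `&` [set x | gamma <= Phi x]) z -> Phi z <= gamma ->
    G z < gamma.
  move=> nz zg; have [zlt|zge] := ltP (Phi z) gamma.
    exact: le_lt_trans (GPhi z) zlt.
  have nFz : ~ F z by move=> Fz; apply: nz.
  have : 0 < e * bump_dist F z by rewrite mulr_gt0// bump_dist_gt0.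
  by rewrite /G; lra.
have [_ nz0 nz1 _] := sep.
have Gz0 := endpoint _ nz0 minimax_value_ge_start.
have Gz1 := endpoint _ nz1 minimax_value_ge_end.
(* The cutoff vanishes at times 0 and 1 and where [c0] is at [bump_dist] at least [e] from [F]:
   these times are frozen. *)
pose chi t := t * (1 - t) * Num.max 0 (e - bump_dist F (c0 t)).
have AP t : A t -> 0 <= t <= 1 by rewrite /= in_itv.
have chi01 t : A t -> 0 <= chi t <= 1.
  move=> /AP /andP[t0 t1].
  have m0 : 0 <= Num.max 0 (e - bump_dist F (c0 t)) by rewrite le_max lexx.
  have m1 : Num.max 0 (e - bump_dist F (c0 t)) <= 1.
    by rewrite ge_max ler01/=; have := bump_dist_ge0 F (c0 t); lra.
  rewrite !mulr_ge0 ?subr_ge0//=.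
  apply: (@le_trans _ _ (1 * 1 * 1)); last by rewrite !mulr1.
  by rewrite !ler_pM ?mulr_ge0 ?subr_ge0// gerBl.
have chi0P t : chi t = 0 -> [\/ t = 0, t = 1 | e <= bump_dist F (c0 t)].
  move=> /eqP; rewrite !mulf_eq0 -orbA => /or3P[/eqP|/eqP|/eqP] h.
  - by constructor 1.
  - by constructor 2; lra.
  - constructor 3; have : e - bump_dist F (c0 t) <= 0 by rewrite -h le_max lexx orbT.
    by rewrite subr_le0.
have chic : {within A, continuous chi}.
  apply/subspace_continuousP => t At; apply: cvgM.
    apply: cvgM; first exact: cvg_within.
    by apply: cvgB; [exact: cvg_cst|exact: cvg_within].
  apply: (@continuous_cvg _ _ _ (within A (nbhs t)) _ c0
    (fun x => Num.max 0 (e - bump_dist F x))).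
    apply: (@continuous_max _ _ (cst 0) (fun x => e - bump_dist F x)).
      exact: cvg_cst.
    by apply: cvgB; [exact: cvg_cst|exact: thc].
  by move/subspace_continuousP : c0c; exact.
pose Z := [set t | chi t = 0].
have Zpath (c : R -> X) : {within A, continuous c} ->
    (forall t, A t -> Z t -> c t = c0 t) -> C0_paths z0 z1 c.
  move=> cc cZ; split => //.
    by rewrite cZ//= /Z /chi /= !mul0r.
  by rewrite cZ//= /Z /chi /= subrr mulr0 mul0r.
pose J c := sup [set G (c t) | t in A].
(* The penalty vanishes where the path meets [F] above level [gamma]. *)
have Jge c : C0_paths z0 z1 c -> gamma <= J c.
  move=> cP; have [t At [Ft gt]] := meets c cP; have [cc _ _] := cP.
  apply: le_trans (path_sup Gc cc t At); rewrite /G.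
  have -> : bump_dist F (c t) = 0.
    apply/eqP; rewrite eq_le bump_dist_ge0 andbT.
    by have := bump_dist_le F (c t) (c t) Ft; rewrite bumpaa.
  by rewrite mulr0 subr0.
have [|c [cc cZ cc0 cmin]] := exists_minimal_path Z Gc c0c e0 (b := gamma).
  by move=> c cc cZ; exact/Jge/Zpath.
rewrite -!/(J _) in cc0 cmin.
have cP := Zpath c cc cZ; have gJ := Jge c cP.
have Jc0 : J c0 < gamma + e ^+ 2.
  by rewrite /J; have [t At [-> _]] := path_height Gc c0c;
    exact: le_lt_trans (GPhi _) (c0_lt t At).
(* The total drop of height is at most [e ^+ 2], and each bump moves by at most the drop divided by
   [e]. *)
have near_c0 t a : A t -> `|bump a (c t) - bump a (c0 t)| <= e.
  move=> At; rewrite -(ler_pM2l e0) -expr2.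
  by apply: le_trans (cc0 t a At) _; lra.
(* No frozen time is a maximum: at endpoints [G] is below [gamma], and far from [F] the penalty
   [e * e] cancels the excess of [Phi (c0 t)] over [gamma]. *)
have chi_gt0 t : A t -> G (c t) = J c -> 0 < chi t.
  move=> At GJ; have /andP[+ _] := chi01 t At.
  rewrite le_eqVlt => /predU1P[/esym chit|//].
  have ct := cZ t At chit.
  have [t0|t1|far] := chi0P t chit.
  - by move: GJ; rewrite ct t0 c00; lra.
  - by move: GJ; rewrite ct t1 c01; lra.
  - have := c0_lt t At; have : e * e <= e * bump_dist F (c0 t) by rewrite ler_pM2l.
    by move: GJ; rewrite ct /G -expr2; lra.
apply: contrapT => none.
have [|c' [h [c'c c'c0 h0 c'J c'near]]] :=
    path_deformation Phic F0 e0 cc chic chi01.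
  move=> t At /= GJ0; have {GJ0}GJ : G (c t) = J c := GJ0.
  have chit := chi_gt0 t At GJ; split => //.
  apply: contrapT => nov; apply: none; exists (c t).
  have th0 : bump_dist F (c0 t) < e.
    by move: chit; rewrite ltNge; apply: contraNlt => ?;
      rewrite /chi max_l ?subr_le0// mulr0.
  have th : bump_dist F (c t) < 2 * e.
    have := bump_dist_leD F (c0 t) (c t) e F0.
    move=> /(_ _)/wrap[a|]; last by lra.
    by have := near_c0 t a At; rewrite ler_norml => /andP[_]; lra.
  split=> //.
    (* [Phi (c t)] is the height, below [gamma + e ^+ 2], plus a penalty below [2 * e ^+ 2]. *)
    have := cc0 t 0 At.
    have : 0 <= e * `|bump 0 (c t) - bump 0 (c0 t)| by rewrite mulr_ge0// ltW.
    have : e * bump_dist F (c t) <= e * (2 * e) by rewrite ler_pM2l// ltW.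
    have : 0 <= e * bump_dist F (c t) by rewrite mulr_ge0 ?bump_dist_ge0// ltW.
    have eE : e * (2 * e) = 2 * e ^+ 2 by ring.
    by move: GJ; rewrite /G eE => ? ? ? ? ?; apply/andP; split; lra.
  move=> v m Dvm; rewrite leNgt; apply/negP => mlt; apply: nov.
  have v0 : 0 < `|v|.
    rewrite lt_neqAle normr_ge0 andbT eq_sym normr_eq0; apply/eqP => v0.
    move: Dvm mlt; rewrite v0 normr0 mulr0 => -[r r0 Hr] m0.
    have := Hr (c t) (r / 2); rewrite subrr normr0 scaler0 addr0 subrr => /(_ r0).
    by rewrite pmulr_rge0 ?divr_gt0// => /(_ _)/wrap[|];
      [apply/andP; split; lra|lra].
  have x0 : 0 < 1 + `|c t| by rewrite ltr_pwDl.
  (* Rescaling [v] to norm exactly one plus the norm of [c t] turns its slope into [- (32 * e)]. *)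
  have k0 : 0 < (1 + `|c t|) / `|v| by rewrite divr_gt0.
  exists (((1 + `|c t|) / `|v|) *: v).
    by rewrite normrZ gtr0_norm// divfK ?gt_eqF.
  have [r r0 Hr] := dir_leZ k0 Dvm; exists r => // w s wr sr.
  apply: le_trans (Hr w s wr sr) _; have /andP[s0 _] := sr.
  rewrite ler_pM2l// mulrAC ler_pdivrMr//.
  move: mlt; rewrite -(ltr_pM2l x0) => /ltW mlt; apply: le_trans mlt _.
  rewrite le_eqVlt; apply/orP; left; apply/eqP; field.
  by rewrite gt_eqF.
have Jc' : J c' <= J c - 12 * e * h.
  apply: ge_sup; first by exists (G (c' 0)), 0.
  by move=> _ [t At <-]; exact: c'J.
have eh : 0 < e * h by rewrite mulr_gt0.
(* Since [e * (8 * h)] is below the drop [12 * e * h], the deformed path competes with the minimal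
   one, which must then have the same height. *)
suff : J c' = J c by lra.
apply: cmin => // [t At chit|t a At]; first exact: c'c0.
have : e * `|bump a (c' t) - bump a (c t)| <= e * (8 * h).
  by rewrite ler_pM2l// c'near.
by rewrite -/(J c'); lra.
Qed.

End NearCritical.

(** * Passage to the limit along almost critical points *)

Lemma locally_lipschitz_continuous {R : realType} {X : normedModType R}
  {Phi : X -> R} : locally_lipschitz Phi -> continuous Phi.
Proof.
move=> lPhi x; have [U Ux lU] := lPhi x.
have [M [M0 HM]] : exists M : R, 0 < M /\
    forall p, (U `*` U) p -> `|Phi p.1 - Phi p.2| <= M * `|p.1 - p.2|.
  by apply: filter_ex (filterI (nbhs_pinfty_gt (num_real 0)) lU).
apply/cvgrPdist_lt => /= d d0.
near=> y.
have : `|Phi x - Phi y| <= M * `|x - y|.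
  apply: (HM (x, y)); split => /=; first exact: nbhs_singleton.
  by near: y.
move/le_lt_trans; apply; rewrite -ltr_pdivlMl//.
near: y; apply: cvgr_dist_lt; first exact: cvg_id.
by rewrite mulr_gt0 ?invr_gt0.
Unshelve. all: by end_near.
Qed.

Theorem theorem1p10 (R : realType) (X : completeNormedModType R)
    (Phi : X -> R) (z0 z1 : X) (F : set X) :
  locally_lipschitz Phi ->
  let gamma := minimax_value Phi z0 z1 in
  let Phi_gamma := [set x : X | gamma <= Phi x] in
  closed F ->
  separates (F `&` Phi_gamma) z0 z1 ->
  CPS Phi F gamma ->
  critical_value Phi gamma.
Proof.
move=> /locally_lipschitz_continuous Phic gamma Phi_gamma cF sep cps.
(* Small enough for [e n <= 1] and for [2 * e n <= 1 / 2], the range of the delta-distance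
   estimate. *)
pose e n : R := 64^-1 * n.+1%:R^-1.
have e0 n : 0 < e n by rewrite mulr_gt0 ?invr_gt0.
have e64 n : e n <= 64^-1.
  by rewrite ler_piMr// invf_le1// ler1n.
have cvge : e n @[n --> \oo] --> (0 : R).
  by rewrite -(mulr0 64^-1); apply: cvgMl_tmp; exact: cvg_harmonic.
have F0 : F !=set0.
  have [c cP _] := @minimax_value_adherent R X Phi z0 z1 Phic 1 ltr01.
  by have [t _ [Ft _]] := path_meets_separator z0 z1 _ c sep cP; exists (c t).
have [n|x Hx] := @choice _ _ (fun n x =>
    [/\ gamma <= Phi x <= gamma + 3 * e n ^+ 2, bump_dist F x < 2 * e n &
    forall v m, dir_le Phi x v m -> - (32 * e n / (1 + `|x|)) * `|v| <= m]).
  by apply: near_critical_point => //; have := e64 n; rewrite e0/=; lra.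
have dist0 : dist_delta (x n) F @[n --> \oo] --> 0%E.
  apply: (@squeeze_cvge _ _ _ _ (cst 0%E) _ (fun n => (2 * (2 * e n))%:E)).
  - near=> n; rewrite dist_delta_ge0/=.
    have [_ /(bump_dist_lt F0)[a Fa ba] _] := Hx n.
    have e4 : 2 * e n <= 1 / 2 by have := e64 n; lra.
    apply: (dist_delta_le _ _ _ _ Fa e4).
    by apply/ltW/(bump_lt ba); lra.
  - exact: cvg_cst.
  - apply: cvg_EFin; first by near=> n.
    by rewrite -[0]/(0%R) -(mulr0 2) -(mulr0 2); do 2 apply: cvgMl_tmp.
have Phig : Phi (x n) @[n --> \oo] --> gamma.
  apply: (@squeeze_cvgr _ _ _ _ (cst gamma) (fun n => gamma + 3 * (e n * e n))).
  - by near=> n; have [] := Hx n.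
  - exact: cvg_cst.
  - rewrite -[X in _ --> X]addr0 -(mulr0 3) -[X in 3 * X](mulr0 0).
    apply: cvgD; first exact: cvg_cst.
    by apply: cvgMl_tmp; apply: cvgM.
have grad n : min_gradient_norm Phi (x n) <= 32 * e n / (1 + `|x n|).
  have [_ _ H] := Hx n; apply: min_gradient_norm_le H _.
  by rewrite divr_ge0 ?addr_ge0// mulr_ge0// ltW.
have grad0 : (1 + `|x n|) * min_gradient_norm Phi (x n) @[n --> \oo] --> (0 : R).
  apply: (@squeeze_cvgr _ _ _ _ (cst 0) (fun n => 32 * e n)).
  - near=> n; rewrite mulr_ge0 ?addr_ge0 ?min_gradient_norm_ge0//=.
    by rewrite mulrC -ler_pdivlMr ?ltr_pwDl.
  - exact: cvg_cst.
  - by rewrite -(mulr0 32); exact: cvgMl_tmp.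
have [k kincr /cvg_ex[/= xb xkxb]] := cps x dist0 Phig grad0.
have kn n : (n <= k n)%N.
  elim: n => // n IHn; apply: leq_ltn_trans IHn _.
  by move/increasing_seqP : kincr; apply.
have kcvg : k n @[n --> \oo] --> \oo.
  move=> S [N _ NS]; exists N => // n /= Nn; apply: NS => /=.
  exact: leq_trans Nn (kn n).
exists xb; split.
  have h1 : Phi (x (k n)) @[n --> \oo] --> Phi xb.
    by apply: continuous_cvg; [exact: Phic|exact: xkxb].
  have h2 : Phi (x (k n)) @[n --> \oo] --> gamma.
    exact: (cvg_comp k (fun n => Phi (x n)) kcvg Phig).
  exact: cvg_unique h1 h2.
split; first exact: cst_continuous.
move=> v /=.
(* The denominators are at least 1, so the slopes are bounded below with constant [32 * e (k n)],
   which tends to 0. *)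
apply: (gen_dir_deriv_limit_ge0 (y := x \o k) (e := fun n => 32 * e (k n)) xkxb).
  rewrite -(mulr0 32); apply: cvgMl_tmp.
  exact: (cvg_comp k e kcvg cvge).
move=> n w m Dm; have [_ _ /(_ w m Dm) h] := Hx (k n).
apply: le_trans h; rewrite !mulNr lerN2 ler_wpM2r//.
rewrite ler_pdivrMr ?ltr_pwDl// ler_peMr ?lerDl// mulr_ge0// ltW//.
Unshelve. all: by end_near.
Qed.
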